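(* Let $\mathbb{F}_q$ be a finite field, $\alpha\in\mathbb{F}_q$ with $\alpha\neq0$, and $n\ge2$. Then $$K_n(\alpha I_n)=q^{n-1}K_1(\alpha)K_{n-1}(\alpha I_{n-1})+q^{2n-2}(q^{n-1}-1)K_{n-2}(\alpha I_{n-2}).$$
   Context: $\mathbb{F}_q$ is a finite field of characteristic $p$. The additive character $\varphi:\mathbb{F}_q\to\mathbb{C}^*$ is $\varphi(x)=\exp(2\pi i\,\mathrm{Tr}_{\mathbb{F}_q/\mathbb{F}_p}(x)/p)$, and $\psi=\varphi\circ\mathrm{tr}$ on $M_n(\mathbb{F}_q)$, where $\mathrm{tr}$ is the matrix trace. For $a\in M_n(\mathbb{F}_q)$, $K_n(a)=\sum_{x\in \mathrm{GL}_n(\mathbb{F}_q)}\psi(ax+x^{-1})$; in particular $K_1(\alpha)=\sum_{x\in\mathbb{F}_q^*}\varphi(\alpha x+x^{-1})$. $I_n$ is the $n\times n$ identity matrix. Convention: $K_0=1$ (the empty-matrix case, which occurs when $n=2$). *)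

(* Defs.v *)
From mathcomp Require Import all_boot all_order all_algebra all_field.
From mathcomp Require Import reals trigo.
From mathcomp Require Import complex.

Set Implicit Arguments.
Unset Strict Implicit.
Unset Printing Implicit Defensive.

Import GRing.Theory Num.Theory.
Local Open Scope ring_scope.
Local Open Scope complex_scope.

(* [pPrimeCharType charFp] is F itself, regarded as a (Galois) extension of
   'F_p; [galTrace] takes its values in the copy of 'F_p inside F, and the
   pick pulls them back to 'F_p (see [absTraceE]). *)
Definition absTrace (p : nat) (F : finFieldType) (charFp : p \in [pchar F])
    (x : F) : 'F_p :=
  let L := pPrimeCharType charFp in
  odflt 0 [pick a : 'F_p | a%:A == galTrace 1%AS {:L}%AS x :> L].

Lemma absTraceE (p : nat) (F : finFieldType) (charFp : p \in [pchar F])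
    (x : F) :
  (absTrace charFp x)%:A =
    galTrace 1%AS {: pPrimeCharType charFp}%AS x :> pPrimeCharType charFp.
Proof.
rewrite /absTrace; case: pickP => [a /eqP-> //|no_a].
have /vlineP[a Da] :
    galTrace 1%AS {: pPrimeCharType charFp}%AS x
      \in (1%AS : {subfield pPrimeCharType charFp}).
  by apply: mem_galTrace; [apply: finField_galois; apply: sub1v | apply: memvf].
by have := no_a a; rewrite Da eqxx.
Qed.

Definition cis (R : realType) (t : R) : R[i] := cos t +i* sin t.

Definition addChar (R : realType) (p : nat) (F : finFieldType)
    (charFp : p \in [pchar F]) (x : F) : R[i] :=
  cis (2 * pi * (absTrace charFp x : nat)%:R / p%:R).

Definition mxChar (R : realType) (p : nat) (F : finFieldType)
    (charFp : p \in [pchar F]) (n : nat) (a : 'M[F]_n) : R[i] :=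
  addChar R charFp (\tr a).

(* GL_n(F) is the set of units of 'M[F]_n rather than the type {'GL_n[F]},
   because the latter is GL_1 when n = 0. *)
Definition Kloosterman (R : realType) (p : nat) (F : finFieldType)
    (charFp : p \in [pchar F]) (n : nat) (a : 'M[F]_n) : R[i] :=
  \sum_(x : 'M[F]_n | x \in unitmx) mxChar R charFp (a *m x + invmx x).

Lemma Kloosterman0 (R : realType) (p : nat) (F : finFieldType)
    (charFp : p \in [pchar F]) (a : 'M[F]_0) : Kloosterman R charFp a = 1.
Proof.
have tr0 : absTrace charFp 0 = 0.
  have /eqP := absTraceE charFp 0.
  by rewrite raddf0 scaler_eq0 oner_eq0 orbF => /eqP.
rewrite /Kloosterman (big_pred1 0) => [|x]; last first.
  by rewrite [x]thinmx0 /= eqxx unitmxE det_mx00 unitr1.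
by rewrite /mxChar /mxtrace big_ord0 /addChar tr0 mulr0 mul0r /cis cos0 sin0.
Qed.

Lemma Kloosterman1 (R : realType) (p : nat) (F : finFieldType)
    (charFp : p \in [pchar F]) (alpha : F) :
  Kloosterman R charFp (alpha%:M : 'M_1) =
    \sum_(x : F | x != 0) addChar R charFp (alpha * x + x^-1).
Proof.
rewrite /Kloosterman (reindex (fun x : F => x%:M : 'M[F]_1)) /=; last first.
  exists (fun A => A 0 0) => [x _|A _]; first by rewrite mxE eqxx.
  by rewrite -mx11_scalar.
apply: eq_big => [x|x _]; first by rewrite unitmxE det_scalar1 unitfE.
by rewrite /mxChar invmx_scalar -scalar_mxM -raddfD mxtrace_scalar.
Qed.

(* Main.v *)
Require Import Defs.
From mathcomp Require Import all_boot all_order all_algebra all_field.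
From mathcomp Require Import ring.
From mathcomp Require Import reals trigo.
From mathcomp Require Import complex.

(** Write [f x] for the summand [phi (\tr (alpha *: x + x^-1))], where [phi] is
    a nontrivial additive character, and let [e] be the first basis vector.
    Right translation by the transvections [1 + N], with [N = e v] for a row
    vector [v] such that [v e = 0], permutes GL_n, and since [N ^ 2 = 0] it
    multiplies [f x] by [phi (v (alpha x - x^-1) e)].  Averaging over [v] and
    using the orthogonality of characters removes every [x] for which
    [(alpha x - x^-1) e] is not a multiple of [e] ([ksum_average]).

    Suppose then that [(alpha x - x^-1) e = c e].  Applying [x] gives
    [alpha x^2 e = c x e + e], so the span of [e] and [x e] is stable under [x].
    There are two cases.

    - It is a line: [e] is an eigenvector of [x], with any nonzero eigenvalue
      [a], and such [x] contribute [q^(n-1) K_1 K_(n-1)]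
      ([sum_kterm_eigenvector]).
    - It is a plane, on which [x] acts by the companion matrix with trace
      [c / alpha] and determinant [- 1 / alpha].  On this plane [alpha x] has
      trace [c] and [x^-1] has trace [- c], so the plane contributes the factor
      [phi 0 = 1] whatever [c] is.  There are [q^n - q] choices of [x e], [q]
      choices of [c], and each gives [q^(2(n-2)) K_(n-2)]
      ([sum_kterm_plane]).

    Both cases are instances of one count, [sum_kterm_invariant]: the matrices
    inducing a prescribed automorphism of a given [m]-dimensional subspace are,
    in an adapted basis, block triangular with one diagonal block fixed, and [f]
    is multiplicative on diagonal blocks.

    The analytic input is only that [addChar] is a nontrivial character, which
    comes from the linear independence of the Galois automorphisms (the trace is
    not zero) and from [cis t <> 1] for [0 < t < 2 pi]. *)

Set Implicit Arguments.
Unset Strict Implicit.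
Unset Printing Implicit Defensive.

Import Order.TTheory GRing.Theory Num.Theory.
Local Open Scope ring_scope.

(** * Block matrices *)

Lemma mulmx1_invmx (R : comUnitRingType) (n : nat) (A B : 'M[R]_n) :
  A *m B = 1%:M -> invmx A = B.
Proof.
move=> AB1; have [uA _] := mulmx1_unit AB1.
by rewrite -[B](mulKmx uA) AB1 mulmx1.
Qed.

Lemma invmx_ublock (R : comUnitRingType) (m n : nat)
    (A : 'M[R]_m) (W : 'M[R]_(m, n)) (D : 'M[R]_n) :
  A \in unitmx -> D \in unitmx ->
  invmx (block_mx A W 0 D) =
    block_mx (invmx A) (- (invmx A *m W *m invmx D)) 0 (invmx D).
Proof.
move=> uA uD; apply: mulmx1_invmx; rewrite mulmx_block !(mulmx0, mul0mx).
rewrite !(addr0, add0r) !mulmxV // mulmxN -mulmxA mulKVmx //.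
by rewrite addNr -scalar_mx_block.
Qed.

Lemma invmx_conj (R : comUnitRingType) (n : nat) (g x : 'M[R]_n) :
  g \in unitmx -> x \in unitmx ->
  invmx (invmx g *m x *m g) = invmx g *m invmx x *m g.
Proof.
move=> ug ux; apply: mulmx1_invmx.
by rewrite !mulmxA mulmxK // mulmxK // mulVmx.
Qed.

(** Gaussian elimination writes [E] as [L * col_mx 1 0 * R] with [L] and [R]
    invertible; the basis is [L] with its first [m] columns multiplied by
    [R]. *)
Lemma row_full_basis (F : fieldType) (m n : nat) (E : 'M[F]_(m + n, m)) :
  row_full E -> exists2 g : 'M[F]_(m + n), g \in unitmx & lsubmx g = E.
Proof.
move=> /eqP rkE.
exists (col_ebase E *m block_mx (row_ebase E) 0 0 1%:M).
  by rewrite unitmx_mul col_ebase_unit block_diag_mx_unit row_ebase_unit unitmx1.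
rewrite -mulmx_lsub block_mxEh row_mxKl.
rewrite -[RHS]mulmx_ebase rkE pid_mx_col -mulmxA mul_col_mx.
by rewrite mul1mx mul0mx.
Qed.

Lemma mulmx_col_10 (R : pzSemiRingType) (m n : nat) (x : 'M[R]_(m + n)) :
  x *m col_mx 1%:M 0 = lsubmx x.
Proof. by rewrite -{1}[x]hsubmxK mul_row_col mulmx1 mulmx0 addr0. Qed.

Lemma lsubmx_col (R : Type) (m n p r : nat) (x : 'M[R]_(m + n, p + r)) :
  lsubmx x = col_mx (ulsubmx x) (dlsubmx x).
Proof. by rewrite -{1}[x]submxK block_mxEh row_mxKl. Qed.

Lemma unitmx_ublock (R : comUnitRingType) (m n : nat)
    (A : 'M[R]_m) (W : 'M[R]_(m, n)) (D : 'M[R]_n) :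
  (block_mx A W 0 D \in unitmx) = (A \in unitmx) && (D \in unitmx).
Proof. by rewrite !unitmxE det_ublock unitrM. Qed.

Lemma row_full_col_10 (F : fieldType) (m n : nat) :
  row_full (col_mx 1%:M 0 : 'M[F]_(m + n, m)).
Proof.
apply/row_fullP; exists (row_mx 1%:M 0).
by rewrite mul_row_col mulmx1 mulmx0 addr0.
Qed.

Lemma row_full_cV (F : fieldType) (m : nat) (d : 'cV[F]_m) :
  d != 0 -> row_full d.
Proof. by move=> d_neq0; rewrite /row_full -mxrank_tr rank_rV trmx_eq0 d_neq0. Qed.

Lemma row_full_ublock (F : fieldType) (m1 m2 n1 n2 : nat) (A : 'M[F]_(m1, n1))
    (W : 'M[F]_(m1, n2)) (D : 'M[F]_(m2, n2)) :
  row_full A -> row_full D -> row_full (block_mx A W 0 D).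
Proof.
move=> /row_fullP[A' A'A] /row_fullP[D' D'D]; apply/row_fullP.
exists (block_mx A' (- (A' *m W *m D')) 0 D').
rewrite mulmx_block !(mulmx0, mul0mx, addr0, add0r) A'A D'D mulNmx.
by rewrite -!mulmxA D'D mulmx1 subrr -scalar_mx_block.
Qed.

(** * Kloosterman sums of a nontrivial additive character *)

Section KloostermanTerm.

Variables (F : finFieldType) (C : numDomainType) (phi : F -> C).
Hypothesis phi0 : phi 0 = 1.
Hypothesis phiD : {morph phi : x y / x + y >-> x * y}.
Hypothesis phi_nontrivial : exists b, phi b != 1.
Variable alpha : F.
Hypothesis alpha_neq0 : alpha != 0.

Local Notation q := (#|F|%:R : C).

Definition kterm (n : nat) (x : 'M[F]_n) : C :=
  phi (\tr (alpha *: x + invmx x)).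

Definition ksum (n : nat) : C := \sum_(x : 'M[F]_n | x \in unitmx) kterm x.

Lemma char_orthogonality (m : nat) (w : 'cV[F]_m) :
  \sum_(v : 'rV[F]_m) phi (\tr (v *m w)) = if w == 0 then q ^+ m else 0.
Proof.
case: eqP => [->|/eqP w_neq0].
  under eq_bigr do rewrite mulmx0 mxtrace0 phi0.
  by rewrite sumr_const card_mx mul1n natrX.
have [b phib] := phi_nontrivial.
have [i wi] := cV0Pn _ w_neq0.
(* Translating the index by a v0 on which the form takes the value b multiplies
   the sum by phi b, so the sum vanishes. *)
pose v0 : 'rV_m := (b / w i 0) *: delta_mx 0 i.
have Ev0 : \tr (v0 *m w) = b.
  by rewrite -scalemxAl -rowE mxtraceZ /mxtrace big_ord1 mxE divfK.
apply/eqP; set S := \sum_v _.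
have : S = phi b * S.
  rewrite {1}/S (reindex_inj (addrI v0)) big_distrr /=.
  by apply: eq_bigr => v _; rewrite mulmxDl raddfD /= Ev0 phiD.
move/eqP; rewrite -subr_eq0 -{1}[S]mul1r -mulrBl mulf_eq0 subr_eq0 eq_sym.
by rewrite (negPf phib).
Qed.

Lemma kterm_ublock (m n : nat) (A : 'M[F]_m) (W : 'M[F]_(m, n)) (D : 'M[F]_n) :
  A \in unitmx -> D \in unitmx ->
  kterm (block_mx A W 0 D) = kterm A * kterm D.
Proof.
move=> uA uD.
by rewrite /kterm invmx_ublock // scale_block_mx add_block_mx mxtrace_block phiD.
Qed.

Lemma kterm_conj (n : nat) (g x : 'M[F]_n) :
  g \in unitmx -> x \in unitmx -> kterm (invmx g *m x *m g) = kterm x.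
Proof.
move=> ug ux; rewrite /kterm invmx_conj //.
rewrite scalemxAl scalemxAr -mulmxDl -mulmxDr mxtrace_mulC mulmxA.
by rewrite mulmxV // mul1mx.
Qed.

(** The condition [x E = E A] says that the column space of [E] is stable under
    [x] and that [x] acts on it by [A] in the basis [E].  After conjugation [E]
    spans the first [m] coordinates, so [x] is block triangular with diagonal
    blocks [A] and an arbitrary invertible [D]; the off-diagonal block is free,
    which gives the power of [q]. *)
Lemma sum_kterm_invariant (m n : nat) (E : 'M[F]_(m + n, m)) (A : 'M[F]_m) :
  row_full E -> A \in unitmx ->
  \sum_(x : 'M[F]_(m + n) | (x \in unitmx) && (x *m E == E *m A)) kterm x
    = q ^+ (m * n) * kterm A * ksum n.
Proof.
move=> /row_full_basis[g ug gE] uA.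
have Ev : E = g *m col_mx 1%:M 0.
  by rewrite mulmx_col_10.
rewrite (reindex (fun x => g *m x *m invmx g)) /=; last first.
  exists (fun x => invmx g *m x *m g) => x _.
    by rewrite !mulmxA mulVmx // mul1mx mulmxKV.
  by rewrite !mulmxA mulmxV // mul1mx mulmxK.
pose B (u : 'M[F]_(m, n) * 'M[F]_n) := block_mx A u.1 0 u.2.
rewrite (reindex B) /=; last first.
  exists (fun x => (ursubmx x, drsubmx x)) => [[W D] _|x].
    by rewrite /B block_mxKur block_mxKdr.
  rewrite inE => /andP[_ /eqP]; rewrite Ev -!mulmxA => /(can_inj (mulKmx ug)).
  rewrite mulKmx // -[x in x *m _]submxK mul_block_col mul_col_mx.
  rewrite !(mulmx0, mulmx1, mul1mx, mul0mx, addr0) => /eq_col_mx[Eul Edl].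
  by rewrite /B /= -[RHS]submxK Eul Edl.
rewrite (eq_big (fun u => u.2 \in unitmx)
                (fun u => kterm A * kterm u.2)); first 1 last.
- move=> [W D] /=; rewrite !unitmx_mul unitmx_inv ug andbT /=.
  rewrite unitmx_ublock uA /= Ev -!mulmxA mulKmx //.
  rewrite mul_block_col mul_col_mx !(mulmx0, mulmx1, mul1mx, mul0mx, addr0).
  by rewrite eqxx andbT.
- move=> [W D] /=; rewrite !unitmx_mul unitmx_inv ug andbT /=.
  rewrite unitmx_ublock uA /= => /andP[uD _].
  have ux : B (W, D) \in unitmx by rewrite unitmx_ublock uA.
  rewrite -(kterm_ublock W uA uD).
  rewrite -[RHS](kterm_conj (g := invmx g)) ?unitmx_inv //.
  by rewrite invmxK.
rewrite -(pair_big xpredT (fun D => D \in unitmx)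
                   (fun (_ : 'M_(m, n)) D => kterm A * kterm D)) /=.
by rewrite sumr_const card_mx -big_distrr /= -natrX -mulrA mulr_natl.
Qed.

(** Translating [x] by the transvection [1 + N v], whose inverse is [1 - N v],
    multiplies the summand by a character of [v]; averaging over [v] leaves the
    [x] for which this character is trivial. *)
Lemma ksum_average (m : nat) :
  ksum (1 + m) = \sum_(x : 'M[F]_(1 + m) | (x \in unitmx) &&
                         (dlsubmx (alpha *: x - invmx x) == 0)) kterm x.
Proof.
have q_neq0 : q ^+ m != 0.
  by rewrite expf_neq0 // pnatr_eq0 -lt0n; apply/card_gt0P; exists 0.
apply: (mulfI q_neq0).
pose N (v : 'rV[F]_m) : 'M[F]_(1 + m) := block_mx 0 v 0 0.
have NN v : N v *m N v = 0.
  by rewrite mulmx_block !(mulmx0, mul0mx) !addr0 block_mx0.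
have U v : (1%:M - N v) *m (1%:M + N v) = 1%:M.
  by rewrite mulmxDr mulmx1 mulmxBl mul1mx NN subr0 subrK.
have U' v : (1%:M + N v) *m (1%:M - N v) = 1%:M.
  by rewrite mulmxBr mulmx1 mulmxDl mul1mx NN addr0 addrK.
have key x v : x \in unitmx -> kterm (x *m (1%:M + N v)) =
    kterm x * phi (\tr (v *m dlsubmx (alpha *: x - invmx x))).
  move=> ux; rewrite /kterm.
  have -> : invmx (x *m (1%:M + N v)) = (1%:M - N v) *m invmx x.
    by apply: mulmx1_invmx; rewrite mulmxA -(mulmxA x) U' mulmx1 mulmxV.
  rewrite -phiD; congr phi.
  have -> : \tr (v *m dlsubmx (alpha *: x - invmx x)) =
            \tr (N v *m (alpha *: x - invmx x)).
    rewrite -[in RHS](submxK (alpha *: x - invmx x)) mulmx_block mxtrace_block.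
    by rewrite !mul0mx add0r addr0 mxtrace0 addr0.
  rewrite mulmxDr mulmxBl mul1mx mulmx1 scalerDr mulmxBr !raddfD /=.
  rewrite !raddfN /= (mxtrace_mulC (N v) (_ *: _)) -scalemxAl.
  by rewrite addrACA.
transitivity (\sum_(v : 'rV[F]_m) \sum_(x : 'M[F]_(1 + m) | x \in unitmx)
                kterm (x *m (1%:M + N v))).
  rewrite (eq_bigr (fun=> ksum (1 + m))) => [|v _].
    by rewrite sumr_const card_mx mul1n -natrX mulr_natl.
  rewrite /ksum [LHS](reindex (fun x => x *m (1%:M - N v))) /=.
    have [_ uv] := mulmx1_unit (U' v).
    apply: eq_big => [x|x _]; first by rewrite unitmx_mul uv andbT.
    by rewrite -mulmxA U mulmx1.
  by exists (fun x => x *m (1%:M + N v)) => x _; rewrite -mulmxA ?U ?U' mulmx1.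
rewrite exchange_big /= big_mkcondr big_distrr /=.
apply: eq_bigr => x ux; under eq_bigr do rewrite key //.
rewrite -big_distrr char_orthogonality /=.
by case: ifP; rewrite ?mulr0 // mulrC.
Qed.

(** The matrix, in the basis [(e, x e)], of an [x] such that
    [alpha x^2 e = c x e + e]. *)
Definition companion (c : F) : 'M[F]_(1 + 1) :=
  block_mx 0 (alpha^-1)%:M 1%:M (c / alpha)%:M.

(** Cayley-Hamilton: [alpha A^2 - c A - 1 = 0], in the form that exhibits the
    inverse of [A]. *)
Lemma mul_companion (c : F) :
  companion c *m (alpha *: companion c - c%:M) = 1%:M.
Proof.
have alphaK : alpha * (c / alpha) = c by rewrite mulrC divfK.
rewrite /companion (scalar_mx_block 1 1 c) scale_block_mx opp_block_mx.
rewrite add_block_mx mulmx_block !(mul0mx, mulmx0, mulmx1, mul1mx).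
rewrite !scaler0 !(add0r, addr0) oppr0 !(mul0mx, addr0, add0r, mulmx1).
rewrite !scale_scalar_mx -!raddfN /= -!raddfD /= -!scalar_mxM -!raddfD /=.
rewrite mulr1 alphaK subrr !mulr0 divfK // mulVf // addNr addr0.
by rewrite mulfV // raddf0 -scalar_mx_block.
Qed.

(** By [mul_companion] the argument of the character is [2 alpha A - c], whose
    trace is [2 c - 2 c]: the contribution of the plane does not depend on
    [c]. *)
Lemma kterm_companion (c : F) : kterm (companion c) = 1.
Proof.
rewrite /kterm (mulmx1_invmx (mul_companion c)).
rewrite addrA mxtraceD raddfN /= mxtrace_scalar raddfD /= mxtraceZ.
rewrite mxtrace_block mxtrace0 mxtrace_scalar add0r mulrC divfK //.
by rewrite mulr2n subrr.
Qed.

(** [sum_kterm_invariant] for the line of the first basis vector, summed over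
    the eigenvalue. *)
Lemma sum_kterm_eigenvector (m : nat) :
  \sum_(x : 'M[F]_(1 + m) | (x \in unitmx) && (dlsubmx x == 0)) kterm x
    = q ^+ m * ksum 1 * ksum m.
Proof.
rewrite (partition_big ulsubmx (fun a : 'M[F]_1 => a \in unitmx)) /=; last first.
  move=> x /andP[+ /eqP x0]; rewrite -{1}[x]submxK x0 unitmx_ublock.
  by case/andP.
rewrite mulrAC [ksum 1]/ksum big_distrr /=.
apply: eq_bigr => a ua; rewrite mulrAC.
have := sum_kterm_invariant (row_full_col_10 F 1 m) ua; rewrite mul1n => <-.
apply: eq_bigl => x; rewrite mulmx_col_10 mul_col_mx mul1mx mul0mx -andbA.
rewrite lsubmx_col; congr (_ && _).
by apply/andP/eqP => [[/eqP-> /eqP->]|/eq_col_mx[-> ->]].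
Qed.

(** Each pair [(u, c)], with [u = x e] off the line of [e] and [c] the scalar
    such that [(alpha x - x^-1) e = c e], contributes [q^(2 n) K_n]; there are
    [q (q^(n+1) - 1)] such vectors [u] and [q] scalars [c]. *)
Lemma sum_kterm_plane (n : nat) :
  \sum_(x : 'M[F]_(1 + (1 + n)) | (x \in unitmx) &&
      (dlsubmx (alpha *: x - invmx x) == 0) && (dlsubmx x != 0)) kterm x
    = q ^+ (2 * n.+1) * (q ^+ n.+1 - 1) * ksum n.
Proof.
pose e : 'cV[F]_(1 + (1 + n)) := col_mx 1%:M 0.
rewrite (partition_big (fun x => (lsubmx x, ulsubmx (alpha *: x - invmx x) 0 0))
           (fun uc : 'cV[F]_(1 + (1 + n)) * F => dsubmx uc.1 != 0)) /=;
  last first.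
  by move=> x /andP[_]; rewrite lsubmx_col col_mxKd.
rewrite (eq_bigr (fun=> q ^+ (2 * n) * ksum n)); last first.
  move=> [u c] /= u_neq0.
  pose E : 'M[F]_(1 + 1 + n, 1 + 1) := row_mx e u.
  have [uA _] := mulmx1_unit (mul_companion c).
  have fullE : row_full E.
    rewrite /E -[u]vsubmxK /e -block_mxEh.
    apply: (@row_full_ublock F 1 (1 + n) 1 1); last exact: row_full_cV.
    by rewrite /row_full mxrank1.
  transitivity (q ^+ ((1 + 1) * n) * kterm (companion c) * ksum n); last first.
    by rewrite kterm_companion mulr1.
  rewrite -(sum_kterm_invariant fullE uA).
  apply: eq_bigl => x; rewrite -!andbA; apply: andb_id2l => ux.
  rewrite /E /companion (mul_mx_row x) mul_row_block mulmx0 add0r mulmx1.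
  rewrite !mul_mx_scalar /e mulmx_col_10 -/e.
  set y := alpha *: x - invmx x.
  (* Multiplying (alpha x - x^-1) e = c e by x, an invertible step, turns it
     into the formula for x u. *)
  have xyE : lsubmx x = u ->
      (lsubmx y == c *: e) = (x *m u == alpha^-1 *: e + (c / alpha) *: u).
    move=> xu; have xyu : x *m lsubmx y = alpha *: (x *m u) - e.
      rewrite -(mulmx_col_10 y) -/e mulmxA mulmxBr -scalemxAr mulmxV //.
      by rewrite mulmxBl mul1mx -scalemxAl -mulmxA [x *m e]mulmx_col_10 xu.
    rewrite -(can_eq (mulKmx ux)) xyu -scalemxAr [x *m e]mulmx_col_10 xu.
    rewrite -[RHS](inj_eq (scalerI alpha_neq0)) scalerDr !scalerA mulfV //.
    by rewrite scale1r [alpha * _]mulrC divfK // subr_eq addrC.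
  have yE : (lsubmx y == c *: e) = (dlsubmx y == 0) && (ulsubmx y 0 0 == c).
    have -> : (ulsubmx y 0 0 == c) = (ulsubmx y == c%:M).
      by apply/eqP/eqP => [<-|->]; rewrite -?mx11_scalar // mxE.
    rewrite lsubmx_col /e scale_col_mx scaler0 scalemx1.
    by apply/eqP/andP => [/eq_col_mx[-> ->] | [/eqP-> /eqP->]].
  rewrite xpair_eqE; apply/and3P/eqP => [[y0 _ /andP[/eqP xu yc]]|].
    by congr row_mx => //; apply/eqP; rewrite -xyE // yE y0.
  case/eq_row_mx=> xu /eqP; rewrite -xyE // yE => /andP[-> ->].
  by move: u_neq0; rewrite -xu eqxx lsubmx_col col_mxKd.
rewrite (eq_bigl (fun uc => (dsubmx uc.1 != 0) && xpredT uc.2)); last first.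
  by move=> uc; rewrite andbT.
rewrite -(pair_big (fun u : 'cV_(1 + (1 + n)) => dsubmx u != 0) xpredT
                   (fun _ _ => q ^+ (2 * n) * ksum n)) /=.
pose K := q * (q ^+ (2 * n) * ksum n).
rewrite (eq_bigr (fun=> K)) => [|u _]; last by rewrite /K mulr_natl sumr_const.
rewrite (reindex (fun u : 'M[F]_1 * 'cV[F]_(1 + n) => col_mx u.1 u.2)) /=;
  last first.
  exists (fun u => (usubmx u, dsubmx u)) => [[s d] _|u _] /=.
    by rewrite col_mxKu col_mxKd.
  by rewrite vsubmxK.
under eq_bigl do rewrite col_mxKd.
rewrite -(pair_big xpredT (fun d : 'cV[F]_(1 + n) => d != 0) (fun _ _ => K)) /=.
have EN : ((#|F| ^ n.+1).-1%:R : C) = q ^+ n.+1 - 1.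
  rewrite -subn1 natrB ?natrX // expn_gt0; apply/orP; left.
  by apply/card_gt0P; exists 0.
rewrite !sumr_const cardC1 !card_mx !muln1 expn1 -mulrnA.
rewrite -[LHS]mulr_natr natrM EN.
by rewrite /K mulnS exprD; ring.
Qed.

Lemma ksum_recurrence (n : nat) :
  ksum n.+2 = q ^+ n.+1 * ksum 1 * ksum n.+1
              + q ^+ (2 * n.+1) * (q ^+ n.+1 - 1) * ksum n.
Proof.
rewrite (ksum_average n.+1) (bigID (fun x : 'M_(1 + n.+1) => dlsubmx x == 0)) /=.
rewrite -(sum_kterm_plane n); congr (_ + _).
rewrite -(sum_kterm_eigenvector n.+1); apply: eq_bigl => x.
rewrite -andbA; apply: andb_id2l => ux.
(* An x that has e as an eigenvector satisfies the condition of [ksum_average],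
   since e is then an eigenvector of x^-1 as well. *)
apply: andb_idl => /eqP x0; move: ux; rewrite -[x]submxK x0 unitmx_ublock.
case/andP=> ua uy; rewrite invmx_ublock // scale_block_mx opp_block_mx.
by rewrite add_block_mx block_mxKdl scaler0 oppr0 addr0.
Qed.

End KloostermanTerm.

Local Open Scope complex_scope.

(** * The character of the absolute trace *)

Section Cis.
Variable R : realType.

Lemma cisD (s t : R) : cis (s + t) = cis s * cis t.
Proof. by rewrite /cis cosD sinD; simpc; rewrite [_ + sin s * _]addrC. Qed.

Lemma cisMn (t : R) (k : nat) : cis (t *+ k) = cis t ^+ k.
Proof.
elim: k => [|k IHk]; first by rewrite /cis mulr0n cos0 sin0.
by rewrite mulrS cisD IHk exprS.
Qed.

Lemma cis2pi : cis (2 * pi) = 1 :> R[i].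
Proof. by rewrite /cis mulr_natl cos2pi sin2pi. Qed.

(** From [cos t = 1 - 2 sin^2 (t / 2)], where [0 < t / 2 < pi]. *)
Lemma cis_neq1 (t : R) : 0 < t < 2 * pi -> cis t != 1.
Proof.
move=> /andP[t_gt0 t_lt]; have s_gt0 : 0 < sin (t / 2).
  by rewrite sin_gt0_pi // divr_gt0 //= ltr_pdivrMr // mulrC.
have cosE : cos t = 1 - sin (t / 2) ^+ 2 *+ 2.
  rewrite -[t in LHS](divfK (_ : 2 != 0)) ?pnatr_eq0 // mulr_natr.
  by rewrite cos_mulr2n cos2sin2 mulrnBl addrAC mulr2n addrK.
apply/eqP => - [/eqP + _]; apply/negP; rewrite lt_eqF // cosE ltrBlDr.
by rewrite ltrDl pmulrn_rgt0 // exprn_gt0.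
Qed.
End Cis.

Section AbsTrace.
Variables (R : realType) (p : nat) (F : finFieldType) (charFp : p \in [pchar F]).

Lemma absTraceD : {morph absTrace charFp : x y / x + y}.
Proof.
move=> x y; apply: (fmorph_inj (in_alg (pPrimeCharType charFp))).
by rewrite rmorphD /= !absTraceE raddfD.
Qed.

(** The trace is the sum of the distinct Galois automorphisms, which are
    linearly independent. *)
Lemma absTrace_neq0 : exists x, absTrace charFp x != 0.
Proof.
set L := pPrimeCharType charFp.
have [x _ nz] := @gal_independent_contra _ L {:L}%AS
  [in 'Gal({:L}%AS / 1%AS)%g] (fun=> 1) _ (fingroup.group1 _) (oner_neq0 _).
exists x; apply: contraNneq nz => tr0; have := absTraceE charFp x.
rewrite tr0 scale0r => /esym; rewrite /galTrace => trx0.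
by under eq_bigr do rewrite mul1r; rewrite trx0.
Qed.

Lemma addCharE x :
  addChar R charFp x = cis (2 * pi / p%:R) ^+ (absTrace charFp x : nat).
Proof. by rewrite -cisMn /addChar mulrAC mulr_natr. Qed.

Lemma addChar0 : addChar R charFp 0 = 1.
Proof.
have /eqP := absTraceD 0 0; rewrite addr0 -subr_eq subrr eq_sym => /eqP tr0.
by rewrite addCharE tr0.
Qed.

(** The representative in [0, p) of a sum is only congruent modulo [p] to the
    sum of the representatives, which is harmless in the exponent of a [p]-th
    root of unity. *)
Lemma addCharD : {morph addChar R charFp : x y / x + y >-> x * y}.
Proof.
have pr_p := pcharf_prime charFp.
move=> x y; rewrite !addCharE -exprD.
have -> : (absTrace charFp (x + y) : nat) =
    ((absTrace charFp x + absTrace charFp y) %% p)%N.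
  by rewrite absTraceD /=; congr (_ %% _)%N; apply: Fp_cast.
apply: expr_mod.
rewrite -cisMn -[_ *+ p]mulr_natr divfK ?cis2pi //.
by rewrite pnatr_eq0 -lt0n prime_gt0.
Qed.

Lemma addChar_nontrivial : exists x, addChar R charFp x != 1.
Proof.
have pr_p := pcharf_prime charFp; have p_gt0 := prime_gt0 pr_p.
have [x trx] := absTrace_neq0; exists x; apply: cis_neq1.
set k : nat := absTrace charFp x.
have k_gt0 : (0 < k)%N by rewrite lt0n.
have k_lt : (k < p)%N by rewrite -[X in (_ < X)%N]Fp_cast ?ltn_ord.
rewrite divr_gt0 ?mulr_gt0 ?pi_gt0 ?ltr0n //=.
by rewrite ltr_pdivrMr ?ltr0n // ltr_pM2l ?ltr_nat // mulr_gt0 ?pi_gt0.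
Qed.
End AbsTrace.

Theorem theorem1p4 (R : realType) (p : nat) (F : finFieldType)
    (charFp : p \in [pchar F]) (alpha : F) (alpha_neq0 : alpha != 0)
    (n : nat) (n_ge2 : (2 <= n)%N) :
  let q : R[i] := #|F|%:R in
  let K (m : nat) : R[i] := Kloosterman R charFp (alpha%:M : 'M[F]_m) in
  K n = q ^+ (n - 1)%N * K 1%N * K (n - 1)%N
        + q ^+ (2 * n - 2)%N * (q ^+ (n - 1)%N - 1) * K (n - 2)%N.
Proof.
move=> q K; have KE m : K m = ksum (addChar R charFp) alpha m.
  by apply: eq_bigr => x _; rewrite /mxChar mul_scalar_mx.
case: n n_ge2 => [|[|n]] // _; rewrite mulnS addKn !KE !subSS !subn0.
exact: (ksum_recurrence (addChar0 R charFp) (addCharD R charFp)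
          (addChar_nontrivial R charFp) alpha_neq0).
Qed.
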